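(* Let $(M,g)$ be a semi-Riemannian manifold of dimension $n\ge3$. Then $$g\big((P\cdot\mathcal R)(X_1,X_2,X_3,X,Y),X_4\big)=(P\cdot R)(X_1,X_2,X_3,X_4,X,Y)$$ holds for all vector fields $X_1,X_2,X_3,X_4,X,Y$ on $M$ if and only if $M$ is Einstein.
   Context: $(M,g)$ is a connected smooth semi-Riemannian manifold of dimension $n\ge 3$; $R$ is the $(0,4)$ Riemann curvature tensor and $\mathcal R$ the $(1,3)$ one, $g(\mathcal R(X,Y)X_1,X_2)=R(X,Y,X_1,X_2)$, with the sign convention that the Ricci tensor $S(X_2,X_3)$ is the $g$-trace of $R(X_1,X_2,X_3,X_4)$ over $X_1,X_4$; $\kappa$ is the scalar curvature. Einstein means $S=\frac{\kappa}{n}g$. Projective curvature tensor: $P(X_1,X_2,X_3,X_4)=R(X_1,X_2,X_3,X_4)-\frac{1}{n-1}\left[S(X_2,X_3)g(X_1,X_4)-S(X_1,X_3)g(X_2,X_4)\right]$, with $(1,3)$-version $\mathcal P$ given by $g(\mathcal P(X,Y)X_1,X_2)=P(X,Y,X_1,X_2)$. For a $(0,4)$-tensor $H$, $(P\cdot H)(X_1,\dots,X_4,X,Y)=-\sum_{i=1}^4H(X_1,\dots,\mathcal P(X,Y)X_i,\dots,X_4)$. For a $(1,3)$-tensor $\mathcal H$, $$(P\cdot\mathcal H)(X_1,X_2,X_3,X,Y)=\mathcal P(X,Y)\mathcal H(X_1,X_2,X_3)-\mathcal H(\mathcal P(X,Y)X_1,X_2,X_3)-\mathcal H(X_1,\mathcal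 P(X,Y)X_2,X_3)-\mathcal H(X_1,X_2,\mathcal P(X,Y)X_3),$$ where $\mathcal R(X_1,X_2,X_3)=\mathcal R(X_1,X_2)X_3$. *)

(* Defs.v *)
From mathcomp Require Import all_boot all_order all_algebra.
From mathcomp Require Import all_classical all_reals all_analysis.

Set Implicit Arguments.
Unset Strict Implicit.
Unset Printing Implicit Defensive.

Import Order.TTheory GRing.Theory Num.Theory.
Import numFieldNormedType.Exports.

Local Open Scope classical_set_scope.
Local Open Scope ring_scope.

(* C^k and C^infty on A; only meant for an open set A, since continuity and
   differentiability are taken in full neighbourhoods of the points of A. *)
Fixpoint Ck_on (R : realType) (V W : normedModType R) (k : nat)
    (A : set V) (f : V -> W) : Prop :=
  match k with
  | 0%N => forall x, A x -> {for x, continuous f}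
  | k'.+1 => (forall x, A x -> differentiable f x) /\
             (forall v : V, Ck_on k' A (fun x => 'D_v f x))
  end.

Definition smooth_on (R : realType) (V W : normedModType R)
    (A : set V) (f : V -> W) : Prop :=
  forall k, Ck_on k A f.

(* A smooth atlas on a Hausdorff second countable space; [coord a] and
   [param a] are arbitrary outside [chart_dom a] and [chart_image a]. *)
Record smoothManifold (R : realType) (n : nat) := SmoothManifold {
  carrier :> topologicalType;
  manifold_hausdorff : hausdorff_space carrier;
  manifold_second_countable : @second_countable carrier;
  chart : Type;
  chart_dom : chart -> set carrier;
  chart_image : chart -> set 'rV[R]_n;
  coord : chart -> carrier -> 'rV[R]_n;
  param : chart -> 'rV[R]_n -> carrier;
  chart_dom_open : forall a, open (chart_dom a);
  chart_image_open : forall a, open (chart_image a);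
  chart_dom_cover : forall p, exists a, chart_dom a p;
  coord_image : forall a p, chart_dom a p -> chart_image a (coord a p);
  param_dom : forall a x, chart_image a x -> chart_dom a (param a x);
  coordK : forall a p, chart_dom a p -> param a (coord a p) = p;
  paramK : forall a x, chart_image a x -> coord a (param a x) = x;
  coord_continuous : forall a p, chart_dom a p ->
    {for p, continuous (coord a)};
  param_continuous : forall a x, chart_image a x ->
    {for x, continuous (param a)};
  transition_smooth : forall a b,
    smooth_on (chart_image a `&` param a @^-1` chart_dom b) (coord b \o param a)
}.

Definition overlap (R : realType) (n : nat) (M : smoothManifold R n)
    (a b : chart M) : set 'rV[R]_n :=
  chart_image a `&` param a @^-1` chart_dom b.

Definition transition (R : realType) (n : nat) (M : smoothManifold R n)
    (a b : chart M) : 'rV[R]_n -> 'rV[R]_n := coord b \o param a.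

(* A vector field is given by its components in the coordinate frame of each
   chart, as functions of the coordinates.  Tangent vectors are row vectors,
   so the Jacobian matrix acts on the right. *)
Record vectorField (R : realType) (n : nat) (M : smoothManifold R n) :=
  VectorField {
  field_comp :> chart M -> 'rV[R]_n -> 'rV[R]_n;
  field_comp_smooth : forall a, smooth_on (chart_image a) (field_comp a);
  field_comp_transition : forall a b x, overlap a b x ->
    field_comp b (transition a b x) = field_comp a x *m 'J (transition a b) x
}.

(* Likewise, a semi-Riemannian metric is given by its Gram matrices in the
   coordinate frames. *)
Record semiRiemannianMetric (R : realType) (n : nat)
    (M : smoothManifold R n) := SemiRiemannianMetric {
  gram :> chart M -> 'rV[R]_n -> 'M[R]_n;
  gram_smooth : forall a, smooth_on (chart_image a) (gram a);
  gram_sym : forall a x, chart_image a x -> (gram a x)^T = gram a x;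
  gram_nondegenerate : forall a x, chart_image a x -> gram a x \in unitmx;
  gram_transition : forall a b x, overlap a b x ->
    gram a x = 'J (transition a b) x *m gram b (transition a b x)
                 *m ('J (transition a b) x)^T
}.

Definition inner (R : realType) (n : nat) (B : 'M[R]_n) (X Y : 'rV[R]_n) : R :=
  (X *m B *m Y^T) 0 0.

(* The vector V such that [inner B V Z = w Z] for all Z, for a linear form w
   and an invertible B. *)
Definition sharp (R : realType) (n : nat) (B : 'M[R]_n) (w : 'rV[R]_n -> R) :
    'rV[R]_n :=
  (\row_k w (delta_mx 0 k)) *m invmx B.

Definition metric_trace (R : realType) (n : nat) (B : 'M[R]_n)
    (b : 'rV[R]_n -> 'rV[R]_n -> R) : R :=
  \sum_i \sum_j invmx B i j * b (delta_mx 0 i) (delta_mx 0 j).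

(* In the definitions below, G is the Gram matrix of a metric in some
   coordinates, as a function of these coordinates, and x is a point. *)

(* The Christoffel symbols of G, by the Koszul formula for vector fields
   with constant components X, Y, Z, whose brackets vanish. *)
Definition christoffel (R : realType) (n : nat) (G : 'rV[R]_n -> 'M[R]_n)
    (x : 'rV[R]_n) (X Y : 'rV[R]_n) : 'rV[R]_n :=
  sharp (G x) (fun Z => 2^-1 *
    ('D_X (fun y => inner (G y) Y Z) x
     + 'D_Y (fun y => inner (G y) X Z) x
     - 'D_Z (fun y => inner (G y) X Y) x)).

(* The Levi-Civita connection in coordinates. *)
Definition nabla (R : realType) (n : nat) (G : 'rV[R]_n -> 'M[R]_n)
    (X Y : 'rV[R]_n -> 'rV[R]_n) (x : 'rV[R]_n) : 'rV[R]_n :=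
  'D_(X x) Y x + christoffel G x (X x) (Y x).

(* R(X,Y)Z = [nabla_X, nabla_Y] Z - nabla_[X,Y] Z, computed by extending the
   tangent vectors X, Y, Z with constant components, so that [X,Y] = 0. *)
Definition riemann13 (R : realType) (n : nat) (G : 'rV[R]_n -> 'M[R]_n)
    (x : 'rV[R]_n) (X Y Z : 'rV[R]_n) : 'rV[R]_n :=
  nabla G (cst X) (nabla G (cst Y) (cst Z)) x
  - nabla G (cst Y) (nabla G (cst X) (cst Z)) x.

Definition riemann04 (R : realType) (n : nat) (G : 'rV[R]_n -> 'M[R]_n)
    (x : 'rV[R]_n) (X1 X2 X3 X4 : 'rV[R]_n) : R :=
  inner (G x) (riemann13 G x X1 X2 X3) X4.

Definition ricci (R : realType) (n : nat) (G : 'rV[R]_n -> 'M[R]_n)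
    (x : 'rV[R]_n) (X2 X3 : 'rV[R]_n) : R :=
  metric_trace (G x) (fun X1 X4 => riemann04 G x X1 X2 X3 X4).

Definition scalar_curvature (R : realType) (n : nat)
    (G : 'rV[R]_n -> 'M[R]_n) (x : 'rV[R]_n) : R :=
  metric_trace (G x) (ricci G x).

Definition projective04 (R : realType) (n : nat) (G : 'rV[R]_n -> 'M[R]_n)
    (x : 'rV[R]_n) (X1 X2 X3 X4 : 'rV[R]_n) : R :=
  riemann04 G x X1 X2 X3 X4
  - (n%:R - 1)^-1 * (ricci G x X2 X3 * inner (G x) X1 X4
                     - ricci G x X1 X3 * inner (G x) X2 X4).

Definition projective13 (R : realType) (n : nat) (G : 'rV[R]_n -> 'M[R]_n)
    (x : 'rV[R]_n) (X Y Z : 'rV[R]_n) : 'rV[R]_n :=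
  sharp (G x) (projective04 G x X Y Z).

(* A . H for a (0,4)-tensor H and a (1,3)-tensor A, at a point. *)
Definition dot04 (R : realType) (n : nat)
    (A : 'rV[R]_n -> 'rV[R]_n -> 'rV[R]_n -> 'rV[R]_n)
    (H : 'rV[R]_n -> 'rV[R]_n -> 'rV[R]_n -> 'rV[R]_n -> R)
    (X1 X2 X3 X4 X Y : 'rV[R]_n) : R :=
  - (H (A X Y X1) X2 X3 X4 + H X1 (A X Y X2) X3 X4
     + H X1 X2 (A X Y X3) X4 + H X1 X2 X3 (A X Y X4)).

(* A . H for (1,3)-tensors A and H, at a point. *)
Definition dot13 (R : realType) (n : nat)
    (A H : 'rV[R]_n -> 'rV[R]_n -> 'rV[R]_n -> 'rV[R]_n)
    (X1 X2 X3 X Y : 'rV[R]_n) : 'rV[R]_n :=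
  A X Y (H X1 X2 X3) - H (A X Y X1) X2 X3
  - H X1 (A X Y X2) X3 - H X1 X2 (A X Y X3).

Definition einstein (R : realType) (n : nat) (M : smoothManifold R n)
    (g : semiRiemannianMetric M) : Prop :=
  forall (a : chart M) (x : 'rV[R]_n), chart_image a x ->
  forall X Y : 'rV[R]_n,
    ricci (g a) x X Y = scalar_curvature (g a) x / n%:R * inner (g a x) X Y.

(* Main.v *)
From HB Require Import structures.
Require Import Defs.
From mathcomp Require Import all_boot all_order all_algebra.
From mathcomp Require Import all_classical all_reals all_analysis.
From mathcomp Require Import ring lra.

Set Implicit Arguments.
Unset Strict Implicit.
Unset Printing Implicit Defensive.

Import Order.TTheory GRing.Theory Num.Theory.
Import numFieldNormedType.Exports.

Local Open Scope classical_set_scope.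
Local Open Scope ring_scope.

(** Write [V = R(X1,X2)X3].  The two sides of the identity differ by
    [P(X,Y,V,W) + P(X,Y,W,V)], in which the skew-symmetric curvature part
    cancels; so the identity says that
    [S(Y,V)g(X,W) - S(X,V)g(Y,W) + S(Y,W)g(X,V) - S(X,W)g(Y,V) = 0]
    for all [V] in the image of the curvature operator.  This holds when [S] is
    a multiple of [g].  Conversely, fix [V <> 0] in this image.  Solving the
    equation and taking a trace gives [S = (kappa/n) g + g(.,V) (x) theta] for
    a linear form [theta].  If [theta <> 0], then every vector of
    the image is a multiple of [V]; a curvature tensor [R(.,.,X3,X4)] that is
    skew in [X3,X4] and has such an image vanishes, a contradiction.

    The identity being assumed for global vector fields only, every tangent
    vector has to be extended to the manifold by means of a smooth bump
    function.  The skew-symmetry of [R] comes from metric compatibility and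
    from the symmetry of second derivatives. *)

(** * C^k calculus *)

(** Differentiability at [x] amounts to a first-order expansion with remainder little-o at 0. Near
    [x] the expansion of [f] is also one of [h], with the same differential. *)
Lemma near_eq_differentiable (R : realType) (V W : normedModType R)
    (f h : V -> W) (x : V) :
  (\near x, f x = h x) -> differentiable f x -> differentiable h x.
Proof.
move=> fh /diff_locallyP [dfc dfo].
have fhx : f x = h x := nbhs_singleton fh.
have dho : h \o shift x = cst (h x) + 'd f x +o_ 0 id.
  apply/eqaddoP => e e0; move/eqaddoP: dfo => /(_ e e0).
  have fh0 : \forall y \near (0 : V), f (y + x) = h (y + x).
    by move: fh; rewrite [X in X -> _](near_shift 0 x) subr0.
  move=> le_fe; near=> y.
  suff -> : (h \o shift x - (cst (h x) + 'd f x)) y =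
            (f \o shift x - (cst (f x) + 'd f x)) y by near: y.
  have fhy : f (y + x) = h (y + x) by near: y.
  by rewrite !fctE /= fhy fhx.
apply/diff_locallyP.
have dh : 'd h x = 'd f x :> (V -> W) by apply: diff_unique.
by rewrite dh.
Unshelve. all: by end_near. Qed.

Section CkCalculus.
Variable R : realType.
Implicit Types V W : normedModType R.

Lemma Ck_on_sub V W k (A B : set V) (f : V -> W) :
  B `<=` A -> Ck_on k A f -> Ck_on k B f.
Proof.
move=> BA; elim: k f => [|k IH] f /=; first by move=> cf x /BA /cf.
by move=> [df Df]; split=> [x /BA /df//|v]; apply: IH.
Qed.

(** Each clause of [Ck_on] is a condition at one point of [A], in full neighbourhoods of it, so [A]
    may be split into singletons. Regularity can then be checked on a different set around each
    point. *)
Lemma Ck_on_pointwise V W k (A : set V) (f : V -> W) :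
  (forall x, A x -> Ck_on k [set x] f) -> Ck_on k A f.
Proof.
elim: k f => [|k IH] f /= fA; first by move=> x Ax; apply: (fA x Ax).
split=> [x Ax|v]; first by have [+ _] := fA x Ax; apply.
by apply: IH => x Ax; have [_] := fA x Ax; apply.
Qed.

Lemma Ck_on_local V W k (A : set V) (f : V -> W) :
  (forall x, A x -> exists2 B : set V, B x & Ck_on k B f) -> Ck_on k A f.
Proof.
move=> fA; apply: Ck_on_pointwise => x /fA [B Bx]; apply: Ck_on_sub.
by move=> _ ->.
Qed.

Lemma Ck_on_near_eq V W k (A : set V) (f h : V -> W) :
  (forall x, A x -> \near x, f x = h x) -> Ck_on k A f -> Ck_on k A h.
Proof.
elim: k f h => [|k IH] f h /= fh.
  move=> cf x Ax; have fhx := fh x Ax.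
  have := cf x Ax; rewrite /prop_for /continuous_at (nbhs_singleton fhx).
  exact: cvg_trans (near_eq_cvg _).
move=> [df Df]; split=> [x Ax|v].
  exact: near_eq_differentiable (fh x Ax) (df x Ax).
apply: IH (Df v) => x Ax.
(* The functions agree near every point close to [x], so their derivatives agree near [x] as
   well. *)
apply: filterS (near_join (fh x Ax)) => y; exact: near_eq_derive.
Qed.

Lemma Ck_onW V W k (A : set V) (f : V -> W) :
  Ck_on k.+1 A f -> Ck_on k A f.
Proof.
elim: k f => [|k IH] f [df Df]; first by move=> x /df /differentiable_continuous.
by split=> // v; apply: IH; apply: Df.
Qed.

Lemma Ck_on_cst V W k (A : set V) (w : W) : Ck_on k A (cst w : V -> W).
Proof.
elim: k w => [|k IH] w /=; first by move=> x _; exact: cst_continuous.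
split=> [x _|v]; first exact: differentiable_cst.
have -> : (fun x => 'D_v (cst w) x) = cst (0 : W) :> (V -> W).
  by apply/funext => x; rewrite derive_cst.
exact: IH.
Qed.

End CkCalculus.

(** * Sums, products, linear images and compositions of C^k maps *)

Section CkAlgebra.
Variable R : realType.
Implicit Types V W : normedModType R.

Lemma Ck_on_eq V W k (A : set V) (f h : V -> W) :
  open A -> (forall x, A x -> f x = h x) -> Ck_on k A f -> Ck_on k A h.
Proof.
move=> oA fh; apply: Ck_on_near_eq => x Ax.
by apply: filterS (open_nbhs_nbhs (conj oA Ax)) => y /fh.
Qed.

Lemma Ck_onD V W k (A : set V) (f h : V -> W) :
  open A -> Ck_on k A f -> Ck_on k A h -> Ck_on k A (fun x => f x + h x).
Proof.
move=> oA; elim: k f h => [|k IH] f h /=.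
  by move=> cf ch x Ax; apply: cvgD; [exact: cf|exact: ch].
move=> [df Df] [dh Dh]; split=> [x Ax|v].
  by apply: differentiableD; [exact: df|exact: dh].
apply: Ck_on_eq (IH _ _ (Df v) (Dh v)) => // x Ax.
by rewrite -deriveD //; apply: diff_derivable; [exact: df|exact: dh].
Qed.

Lemma Ck_on_sum V W k (A : set V) (I : Type) (r : seq I) (P : pred I)
    (f : I -> V -> W) :
  open A -> (forall i, P i -> Ck_on k A (f i)) ->
  Ck_on k A (fun x => \sum_(i <- r | P i) f i x).
Proof.
move=> oA fA; elim: r => [|i r IH].
  rewrite (_ : (fun _ => _) = cst 0); first exact: Ck_on_cst.
  by apply/funext => x; rewrite big_nil.
case: (boolP (P i)) => Pi.
  rewrite (_ : (fun _ => _) =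
    fun x => f i x + \sum_(j <- r | P j) f j x); last first.
    by apply/funext => x; rewrite big_cons Pi.
  by apply: Ck_onD => //; exact: fA.
rewrite (_ : (fun _ => _) = fun x => \sum_(j <- r | P j) f j x) //.
by apply/funext => x; rewrite big_cons (negbTE Pi).
Qed.

Lemma Ck_onM V k (A : set V) (f h : V -> R) :
  open A -> Ck_on k A f -> Ck_on k A h -> Ck_on k A (fun x => f x * h x).
Proof.
move=> oA; elim: k f h => [|k IH] f h.
  by move=> cf ch x Ax; apply: continuousM; [exact: cf|exact: ch].
move=> cf ch; have [df Df] := cf; have [dh Dh] := ch; split=> [x Ax|v].
  by apply: differentiableM; [exact: df|exact: dh].
apply: (@Ck_on_eq _ _ _ _
  (fun x => f x * 'D_v h x + h x * 'D_v f x)) => // [x Ax|].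
  rewrite -[RHS]/('D_v (f * h) x) deriveM //; apply: diff_derivable;
    [exact: df|exact: dh].
apply: Ck_onD => //; apply: IH; do ?[exact: Ck_onW]; [exact: Dh|exact: Df].
Qed.

Lemma Ck_on_linear V W (W' : normedModType R) k (A : set V)
    (L : W -> W') (f : V -> W) :
  open A -> linear L -> continuous L -> Ck_on k A f -> Ck_on k A (L \o f).
Proof.
move=> oA linL; have [L' ->] : exists L' : {linear W -> W'}, L = L'.
  pose LM := GRing.isLinear.Build _ _ _ _ _ linL.
  by pose L0 : {linear W -> W'} := HB.pack L LM; exists L0.
move=> cL; elim: k f => [|k IH] f.
  by move=> cf x Ax; apply: continuous_comp; [exact: cf|exact: cL].
move=> [df Df].
have dL y : differentiable L' y by exact: linear_differentiable.
split=> [x Ax|v]; first by apply: differentiable_comp => //; exact: df.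
apply: Ck_on_eq (IH _ (Df v)) => // x Ax /=.
have dfx := df x Ax.
rewrite !deriveE //; last exact: differentiable_comp.
by rewrite (diff_comp dfx (dL _)) /= diff_lin.
Qed.

Lemma Ck_on_coord V k m p (A : set V) (f : V -> 'M[R]_(m, p)) i j :
  open A -> Ck_on k A f -> Ck_on k A (fun x => f x i j).
Proof.
move=> oA; apply: (@Ck_on_linear _ _ _ _ _ (fun M : 'M[R]_(m, p) => M i j)) => //.
  by move=> a M N; rewrite !mxE.
exact: coord_continuous.
Qed.

Lemma Ck_on_mx V k m p (A : set V) (f : V -> 'M[R]_(m, p)) :
  open A -> (forall i j, Ck_on k A (fun x => f x i j)) -> Ck_on k A f.
Proof.
move=> oA fA.
have -> : f = fun x => \sum_i \sum_j f x i j *: delta_mx i j.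
  by apply/funext => x; exact: matrix_sum_delta.
apply: Ck_on_sum => // i _; apply: Ck_on_sum => // j _.
pose L (c : R) : 'M[R]_(m, p) := c *: delta_mx i j.
apply: (@Ck_on_linear _ _ _ _ _ L (fun x => f x i j)) => //.
  by move=> a b c; rewrite /L scalerDl scalerA.
exact: scalel_continuous.
Qed.

Lemma diff_row_sum_delta W n (h : 'rV[R]_n -> W) (y u : 'rV[R]_n) :
  differentiable h y ->
  'd h y u = \sum_j u 0 j *: 'D_(delta_mx 0 j) h y.
Proof.
move=> dh; rewrite [in LHS](row_sum_delta u) linear_sum; apply: eq_bigr => j _.
by rewrite linearZ deriveE.
Qed.

Lemma Ck_on_comp V n k (A : set V) (B : set 'rV[R]_n) (f : V -> 'rV[R]_n)
    (h : 'rV[R]_n -> R) :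
  open A -> (forall x, A x -> B (f x)) ->
  Ck_on k A f -> Ck_on k B h -> Ck_on k A (h \o f).
Proof.
move=> oA AB; elim: k f h AB => [|k IH] f h AB.
  move=> cf ch x Ax; apply: continuous_comp; first exact: cf.
  exact/ch/AB.
move=> cf ch; have [df Df] := cf; have [dh Dh] := ch; split=> [x Ax|v].
  by apply: differentiable_comp; [exact: df|exact/dh/AB].
(* The chain rule in coordinates: the derivative is a sum of products of factors to which the
   induction hypothesis or the regularity of [f] applies. *)
apply: (@Ck_on_eq _ _ _ _
  (fun x => \sum_j 'D_v f x 0 j * 'D_(delta_mx 0 j) h (f x))) => // [x Ax|].
  have dfx := df x Ax; have dhx := dh _ (AB _ Ax).
  rewrite [in RHS]deriveE; last exact: differentiable_comp.
  by rewrite (diff_comp dfx dhx) /= diff_row_sum_delta // deriveE.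
apply: Ck_on_sum => // j _; apply: Ck_onM => //.
  by apply: Ck_on_coord => //; apply: Df.
exact: (IH f ('D_(delta_mx 0 j) h) AB (Ck_onW cf) (Dh _)).
Qed.

Lemma Ck_on_comp_mx V n k m p (A : set V) (B : set 'rV[R]_n)
    (f : V -> 'rV[R]_n) (h : 'rV[R]_n -> 'M[R]_(m, p)) :
  open A -> open B -> (forall x, A x -> B (f x)) ->
  Ck_on k A f -> Ck_on k B h -> Ck_on k A (h \o f).
Proof.
move=> oA oB AB cf ch; apply: Ck_on_mx => // i j.
exact: (Ck_on_comp (h := fun y => h y i j) oA AB cf (Ck_on_coord i j oB ch)).
Qed.

End CkAlgebra.

(** * A smooth bump function *)

Section FlatExp.
Variable R : realType.

(** The classical flat function $e^{-1/s}$ is the case [m = 0]. The powers of $1/s$ are included so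
    that the family is closed under differentiation up to linear combinations. *)
Definition flat_exp (m : nat) (s : R) : R :=
  if 0 < s then s^-1 ^+ m * expR (- s^-1) else 0.

(** With $t = 1/s > 0$, the exponential series gives $t^{m+2} \le (m+2)!\,e^t$. The quadratic bound
    forces the derivative at 0 to vanish. *)
Lemma flat_exp_le (m : nat) (s : R) : `|flat_exp m s| <= m.+2`!%:R * s ^+ 2.
Proof.
rewrite /flat_exp; case: ifPn => [s0|_]; last first.
  by rewrite normr0 mulr_ge0 // sqr_ge0.
have t0 : 0 < s^-1 by rewrite invr_gt0.
have := @expR_ge1Dxn R s^-1 m.+1 (ltW t0).
set F := (m.+2`!%:R : R); have F0 : 0 < F by rewrite ltr0n fact_gt0.
move=> le_exp.
have {}le_exp : s^-1 ^+ m.+2 <= F * expR s^-1.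
  rewrite -ler_pdivrMl // mulrC; apply: le_trans le_exp.
  by rewrite lerDr.
rewrite ger0_norm; last by rewrite mulr_ge0 ?expR_ge0 // exprn_ge0 // ltW.
rewrite expRN ler_pdivrMr ?expR_gt0 //.
rewrite mulrAC -ler_pdivrMr ?exprn_gt0 // -exprVn -exprD.
by rewrite addn2.
Qed.

Lemma is_derive_flat_exp (m : nat) (s : R) :
  is_derive s 1 (flat_exp m) (flat_exp m.+2 s - m%:R * flat_exp m.+1 s).
Proof.
have [s0|s0|s0] := ltgtP 0 s.
- have E : \near s, s^-1 ^+ m * expR (- s^-1) = flat_exp m s.
    have : \forall y \near s, 0 < y.
      by apply: open_nbhs_nbhs; split; first exact: open_gt.
    by apply: filterS => y y0; rewrite /flat_exp y0.
  apply: near_eq_is_derive E _.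
  have dV : is_derive s 1 (fun y : R => y^-1) (- s ^- 2).
    apply: DeriveDef; first by apply: (@derivableV _ _ id) => //; rewrite gt_eqF.
    by rewrite (@deriveV _ _ id) ?gt_eqF // derive_id [_ *: _]mulr1.
  have dX := is_deriveX m dV; rewrite exprfctE in dX.
  have dE := @is_derive1_comp _ expR (fun y => - y^-1) s _ _
    (is_derive_expR _) (is_deriveN dV).
  have [dM DM] := is_deriveM dX dE.
  apply: DeriveDef; first exact: dM.
  rewrite [LHS]DM /flat_exp s0 /GRing.scale /= opprK -exprVn.
  (* The power rule involves [m.-1], which is truncated at [m = 0]; hence the separate case. *)
  by case: (m) => [|k]; rewrite /= ?mul0r ?mul1r ?expr0 !exprS; ring.
- have E : \near s, cst 0 s = flat_exp m s.
    have : \forall y \near s, y < 0 by exact: lt_nbhsl.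
    by apply: filterS => y y0; rewrite /flat_exp lt_gtF.
  apply: near_eq_is_derive E _.
  rewrite /flat_exp lt_gtF // mulr0 subr0; exact: is_derive_cst.
- rewrite -{s}s0.
  have F0 k : flat_exp k 0 = 0 by rewrite /flat_exp ltxx.
  set C : R := m.+2`!%:R; have C0 : 0 < C by rewrite ltr0n fact_gt0.
  (* The difference quotient at 0 is at most [C * |h|] in absolute value, hence the radius
     [e / C]. *)
  have dF : h^-1 *: ((flat_exp m \o shift 0) (h *: 1) - flat_exp m 0)
      @[h --> 0^'] --> (0 : R).
    apply/cvgrPdist_le => e e0.
    have eC0 : 0 < e / C by rewrite divr_gt0.
    near=> h; rewrite F0 sub0r normrN subr0 /= addr0 [h%:A]mulr1.
    rewrite [_ *: _]/(_ * _) normrM normfV.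
    have h0 : h != 0 by near: h; exact: nbhs_dnbhs_neq.
    rewrite ler_pdivrMl ?normr_gt0 //.
    apply: (le_trans (flat_exp_le m h)).
    rewrite -real_normK ?num_real // -/C expr2 mulrCA.
    rewrite ler_wpM2l // mulrC -ler_pdivlMr //.
    by near: h; exact: dnbhs0_le.
  apply: DeriveDef; first by apply/cvg_ex; exists 0.
  by rewrite !F0 mulr0 subrr; apply: cvg_lim.
Unshelve. all: by end_near. Qed.

(** The induction on [k] is uniform in [m], since the derivative of [flat_exp m] is a combination of
    the functions with indices [m.+1] and [m.+2]. *)
Lemma Ck_on_flat_exp (V : normedModType R) (k m : nat) (A : set V) (q : V -> R) :
  open A -> (forall i, Ck_on i A q) -> Ck_on k A (fun x => flat_exp m (q x)).
Proof.
move=> oA cq; elim: k m => [|k IH] m.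
  move=> x Ax; apply: continuous_comp; first exact: (cq 0).
  apply/differentiable_continuous/derivable1_diffP.
  exact: (@ex_derive _ _ _ _ _ _ _ (is_derive_flat_exp m (q x))).
have dflat s : differentiable (flat_exp m) s.
  by apply/derivable1_diffP; case: (is_derive_flat_exp m s).
have [dq Dq] := cq 1.
split=> [x Ax|v].
  apply: (@differentiable_comp _ _ _ _ q (flat_exp m)) => //; exact: dq.
apply: (@Ck_on_eq _ _ _ _ _ (fun x =>
    'D_v q x * (flat_exp m.+2 (q x) - m%:R * flat_exp m.+1 (q x)))) => //.
  move=> x Ax; have dqx := dq x Ax.
  rewrite [RHS](@deriveE _ _ _ (flat_exp m \o q)); last exact: differentiable_comp.
  rewrite (diff_comp dqx (dflat _)) /= -(deriveE v dqx).
  rewrite diff1E // /GRing.scale /= derive1E; congr (_ * _).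
  by have [_ ->] := is_derive_flat_exp m (q x).
apply: Ck_onM => //; first by have [_] := cq k.+1; exact.
apply: (@Ck_on_eq _ _ _ _ _ (fun x =>
  flat_exp m.+2 (q x) + - m%:R * flat_exp m.+1 (q x))) => //.
  by move=> x _; rewrite mulNr.
by apply: Ck_onD => //; apply: Ck_onM => //; exact: Ck_on_cst.
Qed.

End FlatExp.

(** * Bump functions of several variables *)

Section Bump.
Variables (R : realType) (n : nat).
Implicit Types (c z : 'rV[R]_n) (r : R).

(** The squared Euclidean distance keeps the argument of [flat_exp] polynomial in [z]. *)
Definition bump c r z : R :=
  flat_exp 0 (r ^+ 2 - \sum_i (z 0 i - c 0 i) ^+ 2).

Lemma bump_center c r : 0 < r -> 0 < bump c r c.
Proof.
move=> r0; rewrite /bump big1 => [|i _]; last by rewrite subrr expr0n.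
by rewrite subr0 /flat_exp exprn_gt0 // expr0 mul1r expR_gt0.
Qed.

(** The norm of row vectors is the maximum norm, which is bounded by the Euclidean one. *)
Lemma bump_support c r z : 0 <= r -> bump c r z != 0 -> `|c - z| <= r.
Proof.
move=> r0; rewrite /bump /flat_exp; case: ifPn => [|_ /eqP //].
rewrite subr_gt0 => lt_r _.
rewrite /Num.norm /= mx_normrE; apply: bigmax_le => // -[i j] _ /=.
rewrite ord1 !mxE -ler_sqr ?nnegrE // real_normK ?num_real //.
apply: le_trans (ltW lt_r); rewrite (bigD1 j) //= -[(c 0 j - _) ^+ 2]sqrrN opprB.
by rewrite lerDl sumr_ge0 // => k _; exact: sqr_ge0.
Qed.

Lemma Ck_on_bump c r k (A : set 'rV[R]_n) : open A -> Ck_on k A (bump c r).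
Proof.
move=> oA; apply: Ck_on_flat_exp => // m; apply: Ck_onD => //.
  exact: Ck_on_cst.
apply: (@Ck_on_eq _ _ _ _ _
  (fun z => -1 * \sum_i (z 0 i - c 0 i) * (z 0 i - c 0 i))) => //.
  by move=> z _; rewrite mulN1r; congr (- _); apply: eq_bigr => i _; rewrite expr2.
apply: Ck_onM => //; first exact: Ck_on_cst.
apply: Ck_on_sum => // i _.
have Cid : Ck_on m A (fun z : 'rV[R]_n => z).
  case: m => [|m]; first by move=> z _; exact: cvg_id.
  split=> [z _|v]; first exact: (ex_diff (is_diff_def := is_diff_id z)).
  rewrite (_ : (fun x => _) = cst v); first exact: Ck_on_cst.
  by apply/funext => z; exact: derive_id.
have Ci : Ck_on m A (fun z : 'rV[R]_n => z 0 i - c 0 i).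
  apply: Ck_onD => //; last exact: Ck_on_cst.
  exact: (Ck_on_coord 0 i oA Cid).
exact: Ck_onM.
Qed.

End Bump.

(** * Extension of tangent vectors to global vector fields *)

Section TangentExtension.
Variables (R : realType) (n : nat) (M : smoothManifold R n).
Implicit Types a b c : chart M.

Lemma open_chart_preimage a (D : set M) :
  open D -> open (chart_image a `&` param a @^-1` D).
Proof.
move=> oD; rewrite openE => x [ax Dx]; apply: filterI.
  by apply: open_nbhs_nbhs; split=> //; exact: chart_image_open.
by apply: (param_continuous ax); apply: open_nbhs_nbhs.
Qed.

Lemma overlap_open a b : open (overlap a b).
Proof. by apply: open_chart_preimage; exact: chart_dom_open. Qed.

Lemma transition_overlap a b x : overlap a b x -> overlap b a (transition a b x).
Proof.
move=> [ax bx]; split; first exact: coord_image.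
by rewrite /= coordK //; exact: param_dom.
Qed.

Lemma transition_comp a b c x : overlap a b x ->
  transition b c (transition a b x) = transition a c x.
Proof. by move=> [_ bx]; rewrite /transition /= coordK. Qed.

Lemma transition_differentiable a b x :
  overlap a b x -> differentiable (transition a b) x.
Proof. by have [+ _] := @transition_smooth _ _ M a b 1 => /[apply]. Qed.

(** The chain rule for the cocycle identity [transition_comp], which holds near [x] because overlaps
    are open. *)
Lemma derive_transition a b c x v : overlap a b x -> overlap a c x ->
  'D_v (transition a c) x =
  'D_v (transition a b) x *m 'J (transition b c) (transition a b x).
Proof.
move=> abx acx; have [ax cx] := acx.
have bcx : overlap b c (transition a b x).
  split; first by have [] := transition_overlap abx.
  by rewrite /= coordK //; case: abx.
have E : \near x, (transition b c \o transition a b) x = transition a c x.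
  have : nbhs x (overlap a b).
    by apply: open_nbhs_nbhs; split=> //; exact: overlap_open.
  by apply: filterS => y aby; exact: transition_comp.
rewrite -(near_eq_derive v E).
have dab := transition_differentiable abx.
have dbc := transition_differentiable bcx.
rewrite deriveE; last exact: differentiable_comp.
by rewrite (diff_comp dab dbc) /= -!deriveE // deriveEjacobian.
Qed.

Lemma derive_transition_id a x v : chart_image a x -> 'D_v (transition a a) x = v.
Proof.
move=> ax; rewrite -[RHS](derive_id x v); apply: near_eq_derive.
have : nbhs x (chart_image a).
  by apply: open_nbhs_nbhs; split=> //; exact: chart_image_open.
by apply: filterS => y ay; exact: paramK.
Qed.

(** The constant field [v] of chart [a], damped by the bump function, read in chart [b] and extended
    by zero outside the domain of [a]. *)
Definition bump_field_comp a (x0 : 'rV[R]_n) (r : R) (v : 'rV[R]_n) b y :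
    'rV[R]_n :=
  if param b y \in chart_dom a then
    bump x0 r (transition b a y) *: 'D_v (transition a b) (transition b a y)
  else 0.

Variables (a : chart M) (x0 : 'rV[R]_n) (r : R) (v : 'rV[R]_n).
Hypothesis r_gt0 : 0 < r.
Hypothesis ball_sub : [set z | `|x0 - z| <= r] `<=` chart_image a.

Let K : set M := param a @` [set z | `|x0 - z| <= r].

(** A closed ball of row vectors is compact, so is its continuous image, and compact sets of a
    Hausdorff space are closed. Closedness in the whole manifold, and not only in the chart, is what
    makes the extension by zero smooth. *)
Lemma bump_support_closed : closed K.
Proof.
apply: compact_closed; first exact: manifold_hausdorff.
apply: continuous_compact.
  apply: continuous_in_subspaceT => z; rewrite inE => /ball_sub.
  exact: param_continuous.
rewrite -[X in compact X]/(closed_ball_ Num.norm x0 r) -closed_ballE //.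
apply: bounded_closed_compact; last exact: closed_ball_closed.
rewrite closed_ballE //; exists (`|x0| + r); split; first exact: num_real.
move=> s lt_s z /= xz; apply: le_trans (ltW lt_s).
by rewrite -[z](subKr x0) (le_trans (ler_normB _ _)) // lerD2l.
Qed.

(** Two open sets cover the chart image: the overlap with [a], where the component is given by a
    smooth formula, and the preimage of the complement of [K], where it vanishes. *)
Lemma bump_field_smooth b : smooth_on (chart_image b) (bump_field_comp a x0 r v b).
Proof.
move=> k; apply: Ck_on_local => y bY.
have [ay|nay] := pselect (chart_dom a (param b y)).
  exists (overlap b a) => //.
  pose w z := bump x0 r z *: 'D_v (transition a b) z.
  apply: (@Ck_on_eq _ _ _ _ _ (w \o transition b a)) => //.
  - exact: overlap_open.
  - by move=> z [bz az]; rewrite /bump_field_comp mem_set.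
  apply: (@Ck_on_comp_mx _ _ _ _ _ _ _ (overlap a b)) => //.
  - exact: overlap_open.
  - exact: overlap_open.
  - exact: transition_overlap.
  - exact: transition_smooth.
  have oab := @overlap_open a b.
  apply: Ck_on_mx => // i j.
  apply: (@Ck_on_eq _ _ _ _ _
    (fun z => bump x0 r z * 'D_v (transition a b) z i j)) => //.
    by move=> z _; rewrite mxE.
  apply: Ck_onM => //; first exact: Ck_on_bump.
  apply: Ck_on_coord => //.
  (* The derivative of the transition map costs one order of regularity. *)
  by have [_] := @transition_smooth _ _ M a b k.+1; exact.
exists (chart_image b `&` param b @^-1` (~` K)).
  split=> //= -[z /ball_sub az E]; apply: nay; rewrite -E.
  exact: param_dom.
apply: (@Ck_on_eq _ _ _ _ _ (cst 0)).
- apply: open_chart_preimage; exact: closed_openC bump_support_closed.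
- move=> z [bz Kz]; rewrite /bump_field_comp; case: ifPn => //.
  rewrite inE => az; rewrite (_ : bump _ _ _ = 0) ?scale0r //.
  apply/eqP; apply: contra_notT Kz => /(bump_support (ltW r_gt0)) le_r.
  by exists (transition b a z) => //; rewrite /transition /= coordK.
- exact: Ck_on_cst.
Qed.

Lemma bump_field_transition b c y : overlap b c y ->
  bump_field_comp a x0 r v c (transition b c y) =
  bump_field_comp a x0 r v b y *m 'J (transition b c) y.
Proof.
move=> bcy; have [bY cy] := bcy.
have cK : param c (transition b c y) = param b y by exact: coordK.
rewrite /bump_field_comp cK; case: ifPn => [|_]; last by rewrite mul0mx.
rewrite inE => ay; have bay : overlap b a y by [].
have acz : overlap a c (transition b a y).
  split; first exact: coord_image.
  by rewrite /preimage /= /transition /= coordK.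
have Ecba : transition c a (transition b c y) = transition b a y.
  exact: transition_comp.
have Ebab : transition a b (transition b a y) = y.
  by rewrite (transition_comp _ bay) /transition /= paramK.
rewrite Ecba (derive_transition v (transition_overlap bay) acz) Ebab.
by rewrite scalemxAl.
Qed.

Definition bump_field : vectorField M :=
  VectorField bump_field_smooth bump_field_transition.

Lemma bump_field_center : bump_field a x0 = bump x0 r x0 *: v.
Proof.
have ax : chart_image a x0 by apply: ball_sub; rewrite /= subrr normr0 ltW.
have E : transition a a x0 = x0 by exact: paramK.
rewrite /bump_field /= /bump_field_comp mem_set ?E ?derive_transition_id //.
exact: param_dom.
Qed.

End TangentExtension.

Lemma tangent_extension (R : realType) (n : nat) (M : smoothManifold R n)
    (a : chart M) (x v : 'rV[R]_n) :
  chart_image a x -> exists X : vectorField M, X a x = v.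
Proof.
move=> ax.
have /nbhs_ballP [e /= e0 be] : nbhs x (chart_image a).
  by apply: open_nbhs_nbhs; split=> //; exact: chart_image_open.
(* Halving the radius puts a closed ball inside the open one. *)
have r0 : 0 < e / 2 by rewrite divr_gt0.
have sub : [set z | `|x - z| <= e / 2] `<=` chart_image a.
  move=> z /= xz; apply: be; rewrite -ball_normE /=; apply: le_lt_trans xz _.
  by rewrite ltr_pdivrMr // ltr_pMr // ltr1n.
(* The bump function is only known to be positive at its centre, so [v] is divided by its value
   there. *)
exists (bump_field ((bump x (e / 2) x)^-1 *: v) r0 sub).
rewrite bump_field_center scalerA mulfV ?scale1r //.
by rewrite gt_eqF // bump_center.
Qed.

(** * Symmetry of second derivatives *)

Section Schwarz.
Variables (R : realType) (V : normedModType R).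
Implicit Types (f : V -> R) (v w x y z : V).

Lemma is_derive_line f z v (t : R) : differentiable f (z + t *: v) ->
  is_derive t 1 (fun u : R => f (z + u *: v)) ('D_v f (z + t *: v)).
Proof.
move=> df.
have E : (fun h : R => h^-1 *: (((fun u : R => f (z + u *: v)) \o shift t) (h *: 1)
           - f (z + t *: v))) =
         (fun h => h^-1 *: ((f \o shift (z + t *: v)) (h *: v) - f (z + t *: v))).
  by apply/funext => h /=; rewrite [h%:A]mulr1 scalerDl addrCA.
have dfv : derivable f (z + t *: v) v by exact: diff_derivable.
by apply: DeriveDef; rewrite /derivable /derive E.
Qed.

Lemma MVT_line f z v (s : R) : 0 < s ->
  (forall t, 0 <= t <= s -> differentiable f (z + t *: v)) ->
  exists2 t, 0 <= t <= s & f (z + s *: v) - f z = s * 'D_v f (z + t *: v).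
Proof.
move=> s0 df.
have dline t (ts : 0 <= t <= s) := is_derive_line (df t ts).
have [||t] := @MVT R (fun u => f (z + u *: v)) (fun u => 'D_v f (z + u *: v))
  0 s s0.
- by move=> t; rewrite in_itv /= => /andP[t0 ts]; apply: dline; rewrite !ltW.
- apply: continuous_in_subspaceT => t; rewrite inE /= in_itv /= => ts.
  apply/differentiable_continuous/derivable1_diffP.
  by have [] := dline t ts.
rewrite in_itv /= => /andP[t0 ts]; rewrite scale0r addr0 subr0 mulrC => ->.
by exists t; rewrite ?ltW.
Qed.

(** The mean value theorem is applied twice: along [v] to the increment $f(y+sw)-f(y)$, then along
    [w] to the derivative of [f] in direction [v]. *)
Lemma second_difference f x v w (e s : R) : 0 < s -> s * (`|v| + `|w|) < e ->
  (forall y, `|x - y| < e -> differentiable f y) ->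
  (forall y, `|x - y| < e -> differentiable ('D_v f) y) ->
  exists2 y, `|x - y| <= s * (`|v| + `|w|) &
    f (x + s *: v + s *: w) - f (x + s *: v) - f (x + s *: w) + f x =
    s * (s * 'D_w ('D_v f) y).
Proof.
move=> s0 se df ddf.
have near_x t u : 0 <= t <= s -> 0 <= u <= s ->
    `|x - (x + t *: v + u *: w)| <= s * (`|v| + `|w|).
  move=> /andP[t0 ts] /andP[u0 us].
  rewrite -addrA opprD addNKr normrN (le_trans (ler_normD _ _)) // mulrDr.
  by rewrite !normrZ !ger0_norm // lerD // ler_wpM2r.
have s_in : 0 <= s <= s by rewrite lexx ltW.
have z_in : 0 <= (0 : R) <= s by rewrite lexx ltW.
pose phi y := f (y + s *: w) - f y.
have dfs t : 0 <= t <= s -> differentiable f (x + t *: v).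
  move=> t_in; apply: (df (x + t *: v)).
  apply: le_lt_trans se.
  by have := near_x t 0 t_in z_in; rewrite scale0r addr0.
have dfsw t : 0 <= t <= s -> differentiable (f \o shift (s *: w)) (x + t *: v).
  move=> t_in; apply: differentiable_comp => //.
  exact: (df _ (le_lt_trans (near_x _ _ t_in s_in) se)).
have [|t t_in E] := @MVT_line phi x v s s0.
  by move=> t t_in; apply: differentiableB; [exact: dfsw|exact: dfs].
have [|u u_in E'] := @MVT_line ('D_v f) (x + t *: v) w s s0.
  by move=> u u_in; apply: ddf; exact: le_lt_trans (near_x _ _ t_in u_in) se.
exists (x + t *: v + u *: w); first exact: (near_x _ _ t_in u_in).
rewrite -E'.
have -> : 'D_v f (x + t *: v + s *: w) = 'D_v (f \o shift (s *: w)) (x + t *: v).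
  rewrite /derive; suff -> : (f \o shift (s *: w)) \o shift (x + t *: v) =
    f \o shift (x + t *: v + s *: w) by [].
  by apply/funext => h /=; rewrite -!addrA.
rewrite -deriveB; [|exact/diff_derivable/dfsw|exact/diff_derivable/dfs].
by rewrite -[RHS]E /phi opprB addrA [RHS]addrAC.
Qed.

(** The second difference is symmetric in [v] and [w], so the two mixed derivatives agree at some
    pair of points arbitrarily close to [x]. By continuity they cannot differ at [x]. *)
Lemma derive_commute (A : set V) f x v w : open A -> Ck_on 2 A f -> A x ->
  'D_v ('D_w f) x = 'D_w ('D_v f) x.
Proof.
move=> oA [df Df] Ax.
have /nbhs_ballP [e /= e0 eA] : nbhs x A by apply: open_nbhs_nbhs.
rewrite -ball_normE /= in eA.
have [dvf cvw] := Df v; have [dwf cwv] := Df w.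
apply/eqP/negP => /negP; rewrite -subr_eq0 -normr_gt0.
set d := `|_ - _| => d0.
have d20 : 0 < d / 2 by rewrite divr_gt0.
have /cvgrPdist_lt /(_ _ d20) /nbhs_ballP [e1 /= e10 le1] := cwv v x Ax.
have /cvgrPdist_lt /(_ _ d20) /nbhs_ballP [e2 /= e20 le2] := cvw w x Ax.
rewrite -ball_normE /= in le1; rewrite -ball_normE /= in le2.
pose m := Num.min e (Num.min e1 e2).
have m0 : 0 < m by rewrite !lt_min e0 e10.
(* The added 1 keeps the step [m / N] well defined when both directions vanish. *)
pose N := `|v| + `|w| + 1.
have N0 : 0 < N by rewrite ltr_wpDl // addr_ge0.
have s0 : 0 < m / N by rewrite divr_gt0.
have sm : m / N * (`|v| + `|w|) < m.
  by rewrite -mulrA gtr_pMr // ltr_pdivrMl // mulr1 ltrDl.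
have smC : m / N * (`|w| + `|v|) < m by rewrite [`|w| + _]addrC.
have me : m <= e by rewrite ge_min lexx.
have [||y ym E] := @second_difference f x v w e _ s0 (lt_le_trans sm me).
- by move=> y /eA /df.
- by move=> y /eA /dvf.
have [||z zm E'] := @second_difference f x w v e _ s0 (lt_le_trans smC me).
- by move=> z /eA /df.
- by move=> z /eA /dwf.
have Eyz : 'D_w ('D_v f) y = 'D_v ('D_w f) z.
  have sn0 : m / N != 0 by rewrite gt_eqF.
  apply: (mulfI sn0); apply: (mulfI sn0); rewrite -E -E'.
  rewrite [x + _ *: w + _]addrAC.
  by rewrite -!addrA; congr (_ + _); rewrite addrCA.
have dy : `|'D_w ('D_v f) x - 'D_w ('D_v f) y| < d / 2.
  apply: le2 => /=; apply: le_lt_trans ym _; apply: lt_le_trans sm _.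
  by rewrite !ge_min lexx !orbT.
have dz : `|'D_v ('D_w f) x - 'D_v ('D_w f) z| < d / 2.
  apply: le1 => /=; apply: le_lt_trans zm _; apply: lt_le_trans smC _.
  by rewrite !ge_min lexx !orbT.
have : d < d / 2 + d / 2.
  apply: le_lt_trans (ltrD dz dy); rewrite -Eyz [X in _ <= _ + X]distrC.
  exact: ler_distD.
by rewrite -splitr ltxx.
Qed.

End Schwarz.

(** * Inner products and metric traces *)

Section Inner.
Variables (R : realType) (n : nat).
Implicit Types (B : 'M[R]_n) (X Y Z V W : 'rV[R]_n).

Lemma innerDl B X Y Z : inner B (X + Y) Z = inner B X Z + inner B Y Z.
Proof. by rewrite /inner !mulmxDl mxE. Qed.

Lemma innerNl B X Z : inner B (- X) Z = - inner B X Z.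
Proof. by rewrite /inner !mulNmx mxE. Qed.

Lemma innerZl B (c : R) X Z : inner B (c *: X) Z = c * inner B X Z.
Proof. by rewrite /inner -!scalemxAl mxE. Qed.

Lemma innerC B X Y : B^T = B -> inner B X Y = inner B Y X.
Proof.
move=> symB; rewrite /inner -[in LHS]trace_mx11 -[in RHS]trace_mx11 -mxtrace_tr.
by rewrite !trmx_mul trmxK symB mulmxA.
Qed.

Lemma innerDr B X Y Z : inner B X (Y + Z) = inner B X Y + inner B X Z.
Proof. by rewrite /inner linearD /= mulmxDr mxE. Qed.

Lemma innerZr B (c : R) X Z : inner B X (c *: Z) = c * inner B X Z.
Proof. by rewrite /inner linearZ /= -scalemxAr mxE. Qed.

Lemma inner_sumE B X Y : inner B X Y = \sum_i \sum_j X 0 i * B i j * Y 0 j.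
Proof.
rewrite /inner mxE exchange_big /=; apply: eq_bigr => j _.
by rewrite mxE !mxE mulr_suml.
Qed.

Lemma inner_delta B X j : inner B X (delta_mx 0 j) = (X *m B) 0 j.
Proof. by rewrite /inner trmx_delta -colE mxE. Qed.

Lemma inner_sharp B (w : 'rV[R]_n -> R) : B \in unitmx -> linear_for *%R w ->
  forall Z, inner B (sharp B w) Z = w Z.
Proof.
move=> uB lw Z; rewrite /inner /sharp mulmxKV // mxE.
have [w' ->] : exists w' : {scalar 'rV[R]_n}, w = w'.
  pose LM := GRing.isLinear.Build _ _ _ _ _ lw.
  by pose L0 : {scalar 'rV[R]_n} := HB.pack w LM; exists L0.
rewrite [in RHS](row_sum_delta Z) linear_sum; apply: eq_bigr => j _.
by rewrite linearZ /= !mxE mulrC.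
Qed.

Lemma inner_eq0 B X : B \in unitmx -> (forall Z, inner B X Z = 0) -> X = 0.
Proof.
move=> uB X0; have : X *m B = 0.
  by apply/rowP => j; rewrite -inner_delta X0 mxE.
by move=> /(congr1 (mulmx^~ (invmx B))); rewrite mulmxK // mul0mx.
Qed.

Lemma inner_neq0 B X : B \in unitmx -> B^T = B -> X != 0 ->
  exists Z, inner B Z X = 1.
Proof.
move=> uB symB; apply: contra_neqP => no.
apply: (inner_eq0 uB) => Z; apply/eqP; apply: contra_notT no => XZ.
exists ((inner B X Z)^-1 *: Z).
by rewrite innerZl (innerC Z X symB) mulVf.
Qed.

(** Contracting with the inverse matrix undoes the lowering of the index of [V], which leaves the
    expansion of [w V] in the standard basis. *)
Lemma metric_trace_innerl B (w : 'rV[R]_n -> R) V : B \in unitmx -> B^T = B ->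
  linear_for *%R w -> metric_trace B (fun X Y => w Y * inner B X V) = w V.
Proof.
move=> uB symB lw; have [w' ->] : exists w' : {scalar 'rV[R]_n}, w = w'.
  pose LM := GRing.isLinear.Build _ _ _ _ _ lw.
  by pose L0 : {scalar 'rV[R]_n} := HB.pack w LM; exists L0.
rewrite /metric_trace [in RHS](row_sum_delta V) linear_sum exchange_big /=.
apply: eq_bigr => j _; rewrite linearZ /=.
rewrite -[in RHS](mulmxK uB V) mxE mulr_suml; apply: eq_bigr => i _.
by rewrite innerC // inner_delta; ring.
Qed.

Lemma metric_trace_inner B : B \in unitmx -> B^T = B ->
  metric_trace B (inner B) = n%:R.
Proof.
move=> uB symB; rewrite -[RHS](mxtrace1 R n) -(mulVmx uB) /metric_trace.
apply: eq_bigr => i _; rewrite mxE; apply: eq_bigr => j _.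
by rewrite innerC // inner_delta -rowE mxE.
Qed.

End Inner.

(** * Skew-symmetry of the curvature *)

Section CurvatureSkew.
Variables (R : realType) (n : nat) (U : set 'rV[R]_n) (G : 'rV[R]_n -> 'M[R]_n).
Hypotheses (oU : open U) (smG : smooth_on U G)
  (symG : forall x, U x -> (G x)^T = G x) (unitG : forall x, U x -> G x \in unitmx).
Implicit Types X Y Z W x : 'rV[R]_n.

Lemma Ck_on_prod (I : Type) (r : seq I) k (f : I -> 'rV[R]_n -> R) :
  (forall i, Ck_on k U (f i)) -> Ck_on k U (fun x => \prod_(i <- r) f i x).
Proof.
move=> fA; elim: r => [|i r IH].
  rewrite (_ : (fun _ => _) = cst 1); first exact: Ck_on_cst.
  by apply/funext => x; rewrite big_nil.
rewrite (_ : (fun _ => _) = fun x => f i x * \prod_(j <- r) f j x).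
  exact: Ck_onM.
by apply/funext => x; rewrite big_cons.
Qed.

Lemma Ck_on_det m k (A : 'rV[R]_n -> 'M[R]_m) :
  (forall i j, Ck_on k U (fun x => A x i j)) -> Ck_on k U (fun x => \det (A x)).
Proof.
move=> cA; apply: Ck_on_sum => // s _; apply: Ck_onM => //.
  exact: Ck_on_cst.
by apply: Ck_on_prod => i; exact: cA.
Qed.

(** By Cramer's rule the entries are, near [x], cofactors divided by the determinant. *)
Lemma differentiable_invmx x i j : U x ->
  differentiable (fun y => invmx (G y) i j) x.
Proof.
move=> Ux.
have cG i' j' : Ck_on 1 U (fun y => G y i' j') by exact: Ck_on_coord.
pose f y := (\det (G y))^-1 * cofactor (G y) j i.
have fE : \near x, f x = invmx (G x) i j.
  have : nbhs x U by apply: open_nbhs_nbhs.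
  by apply: filterS => y Uy; rewrite /f /invmx unitG // !mxE.
apply: near_eq_differentiable fE _; apply: differentiableM.
  apply: differentiableV; first by have [+ _] := Ck_on_det cG; apply.
  by rewrite -unitfE; exact: unitG.
have [+ _] : Ck_on 1 U (fun y => cofactor (G y) j i); last exact.
apply: Ck_onM => //; first exact: Ck_on_cst.
by apply: Ck_on_det => i' j'; rewrite (_ : (fun _ => _) = fun y =>
  G y (lift j i') (lift i j')) //; apply/funext => y; rewrite !mxE.
Qed.

Lemma Ck_on_inner k X Y : Ck_on k U (fun y => inner (G y) X Y).
Proof.
rewrite (_ : (fun _ => _) =
  fun y => \sum_i \sum_j (X 0 i * Y 0 j) * G y i j); last first.
  apply/funext => y; rewrite inner_sumE; apply: eq_bigr => i _.
  by apply: eq_bigr => j _; ring.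
apply: Ck_on_sum => // i _; apply: Ck_on_sum => // j _; apply: Ck_onM => //.
  exact: Ck_on_cst.
exact: Ck_on_coord.
Qed.

Lemma differentiable_inner x X Y : U x -> differentiable (fun y => inner (G y) X Y) x.
Proof. by have [+ _] := Ck_on_inner 1 X Y; apply. Qed.

Lemma derivable_inner x X Y v : U x -> derivable (fun y => inner (G y) X Y) x v.
Proof. by move=> Ux; apply: diff_derivable; exact: differentiable_inner. Qed.

Lemma derive_innerDr x X (a : R) Y Z v : U x ->
  'D_v (fun y => inner (G y) X (a *: Y + Z)) x =
  a * 'D_v (fun y => inner (G y) X Y) x + 'D_v (fun y => inner (G y) X Z) x.
Proof.
move=> Ux; rewrite (_ : (fun y => inner (G y) X (a *: Y + Z)) =
  a *: (fun y => inner (G y) X Y) + (fun y => inner (G y) X Z)).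
  rewrite deriveD ?deriveZ //; [exact: derivable_inner| |exact: derivable_inner].
  by apply: derivableZ; exact: derivable_inner.
by apply/funext => y; rewrite innerDr innerZr.
Qed.

(** The Koszul expression is linear in [Z], by bilinearity of the metric and linearity of the
    differential, so [sharp] represents it. *)
Lemma christoffel_koszul x X Y Z : U x ->
  inner (G x) (christoffel G x X Y) Z =
  2^-1 * ('D_X (fun y => inner (G y) Y Z) x + 'D_Y (fun y => inner (G y) X Z) x
          - 'D_Z (fun y => inner (G y) X Y) x).
Proof.
move=> Ux; rewrite inner_sharp //; first exact: unitG.
move=> a Z1 Z2; rewrite !derive_innerDr //.
have -> : 'D_(a *: Z1 + Z2) (fun y => inner (G y) X Y) x =
    a * 'D_Z1 (fun y => inner (G y) X Y) x + 'D_Z2 (fun y => inner (G y) X Y) x.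
  by have d := differentiable_inner X Y Ux; rewrite !deriveE // linearP.
have lin (p q r p' q' r' : R) : 2^-1 * (a * p + p' + (a * q + q') - (a * r + r')) =
    a * (2^-1 * (p + q - r)) + 2^-1 * (p' + q' - r') by ring.
exact: lin.
Qed.

Lemma near_innerC x X Y : U x -> \near x, inner (G x) X Y = inner (G x) Y X.
Proof.
move=> Ux; have : nbhs x U by apply: open_nbhs_nbhs.
by apply: filterS => y Uy; rewrite innerC // symG.
Qed.

(** Metric compatibility for constant fields: in the sum of the two Koszul formulas the derivatives
    along [Y] and [Z] cancel. *)
Lemma christoffel_compat x X Y Z : U x ->
  'D_X (fun y => inner (G y) Y Z) x =
  inner (G x) (christoffel G x X Y) Z + inner (G x) (christoffel G x X Z) Y.
Proof.
move=> Ux; rewrite !christoffel_koszul //.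
rewrite (near_eq_derive X (near_innerC Z Y Ux)) [in RHS]addrAC.
by rewrite -[LHS]mulr1; field.
Qed.

Lemma derivable_christoffel x X Y v : U x ->
  derivable (fun y => christoffel G y X Y) x v.
Proof.
move=> Ux; apply/derivable_mxP => i j; apply: diff_derivable.
pose w y k : R := 2^-1 * ('D_X (fun y => inner (G y) Y (delta_mx 0 k)) y
     + 'D_Y (fun y => inner (G y) X (delta_mx 0 k)) y
     - 'D_(delta_mx 0 k) (fun y => inner (G y) X Y) y).
rewrite (_ : (fun y => _) = \sum_k (fun y => w y k * invmx (G y) k j)).
  apply: differentiable_sum => k; apply: differentiableM; last first.
    exact: differentiable_invmx.
  have dD v' Y1 Y2 : differentiable ('D_v' (fun y => inner (G y) Y1 Y2)) x.
    by have [_ /(_ v') [+ _]] := Ck_on_inner 2 Y1 Y2; apply.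
  apply: differentiableM; first exact: differentiable_cst.
  by apply: differentiableB => //; exact: differentiableD.
apply/funext => y; rewrite fct_sumE !mxE; apply: eq_bigr => k _.
by rewrite !mxE.
Qed.

Lemma is_derive_inner x (u : 'rV[R]_n -> 'rV[R]_n) W v : U x -> derivable u x v ->
  is_derive x v (fun y => inner (G y) (u y) W)
    (inner (G x) ('D_v u x) W + 'D_v (fun y => inner (G y) (u x) W) x).
Proof.
move=> Ux du.
have innerE y (z : 'rV[R]_n) : inner (G y) z W =
    \sum_i z 0 i * inner (G y) (delta_mx 0 i) W.
  rewrite {1}(row_sum_delta z) /inner !mulmx_suml summxE.
  by apply: eq_bigr => i _; rewrite -!scalemxAl mxE.
have dui i := (derivable_mxP _ _ _).1 du 0 i.
have -> : (fun y => inner (G y) (u y) W) =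
    \sum_i ((fun y => u y 0 i) * (fun y => inner (G y) (delta_mx 0 i) W)).
  by apply/funext => y; rewrite fct_sumE innerE.
have -> : (fun y => inner (G y) (u x) W) =
    \sum_i (u x 0 i *: (fun y => inner (G y) (delta_mx 0 i) W)).
  by apply/funext => y; rewrite fct_sumE innerE.
have dg i : derivable (fun y => inner (G y) (delta_mx 0 i) W) x v.
  exact: derivable_inner.
apply: DeriveDef; first by apply: derivable_sum => i; exact: derivableM.
rewrite !derive_sum; [|by move=> i; exact: derivableZ|by move=> i; exact: derivableM].
rewrite innerE -big_split; apply: eq_bigr => i _ /=.
rewrite (deriveM (dui i) (dg i)) (deriveZ (u x 0 i) (dg i)) (derive_mx du) mxE.
by rewrite addrC [_ *: 'D_v (fun y => u y 0 i) x]mulrC.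
Qed.

(** This is $\nabla_X\nabla_Y Z$ at [x] for fields with constant components. *)
Definition second_covariant x X Y Z :=
  'D_X (fun y => christoffel G y Y Z) x + christoffel G x X (christoffel G x Y Z).

Lemma riemann13E x X Y Z :
  riemann13 G x X Y Z = second_covariant x X Y Z - second_covariant x Y X Z.
Proof.
have nablaE V1 V2 :
    nabla G (cst V1) (cst V2) = fun y => christoffel G y V1 V2.
  by apply/funext => y; rewrite /nabla derive_cst add0r.
by rewrite /riemann13 !nablaE.
Qed.

(** The identity [christoffel_compat] along [Y] is differentiated along [X], and compatibility is
    used again for the derivatives of the metric. *)
Lemma second_covariant_skew x X Y Z W : U x ->
  inner (G x) (second_covariant x X Y Z) W + inner (G x) (second_covariant x X Y W) Z =
  'D_X ('D_Y (fun y => inner (G y) Z W)) x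
  - inner (G x) (christoffel G x Y Z) (christoffel G x X W)
  - inner (G x) (christoffel G x Y W) (christoffel G x X Z).
Proof.
move=> Ux.
have [d1 D1] := is_derive_inner W Ux (@derivable_christoffel x Y Z X Ux).
have [d2 D2] := is_derive_inner Z Ux (@derivable_christoffel x Y W X Ux).
have E : \near x, inner (G x) (christoffel G x Y Z) W
    + inner (G x) (christoffel G x Y W) Z = 'D_Y (fun y => inner (G y) Z W) x.
  have : nbhs x U by apply: open_nbhs_nbhs.
  by apply: filterS => y Uy; rewrite christoffel_compat.
rewrite -(near_eq_derive X E).
have := deriveD d1 d2; rewrite D1 D2 !christoffel_compat // => ->.
rewrite /second_covariant.
(* The Christoffel terms are abstracted: otherwise matching unfolds them. *)
move: ('D_X (fun y => christoffel G y Y Z) x) ('D_X (fun y => christoffel G y Y W) x)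
  (christoffel G x X (christoffel G x Y Z)) (christoffel G x X (christoffel G x Y W))
  => d d' c c'.
move: (christoffel G x Y Z) (christoffel G x Y W)
  (christoffel G x X Z) (christoffel G x X W) => p p' q q'.
rewrite !innerDl (innerC q' p (symG Ux)) (innerC q p' (symG Ux)).
move: (inner _ d W) (inner _ d' Z) (inner _ c W) (inner _ c' Z) (inner _ p q')
  (inner _ p' q) => *; ring.
Qed.

(** The right-hand side of [second_covariant_skew] is symmetric in [X] and [Y]: the second
    derivatives commute and the two Christoffel products are exchanged. Antisymmetrizing in [X] and
    [Y] thus gives 0. *)
Lemma riemann04_skew x X Y Z W : U x ->
  riemann04 G x X Y Z W = - riemann04 G x X Y W Z.
Proof.
move=> Ux; have := @second_covariant_skew x Y X Z W Ux.
have := @second_covariant_skew x X Y Z W Ux.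
rewrite (derive_commute _ _ oU (Ck_on_inner 2 Z W) Ux) /riemann04 !riemann13E.
move: ('D_Y _ x) (second_covariant x X Y Z) (second_covariant x Y X Z)
  (second_covariant x X Y W) (second_covariant x Y X W)
  (christoffel G x Y Z) (christoffel G x Y W)
  (christoffel G x X Z) (christoffel G x X W) => D A B A' B' p p' q q'.
rewrite !innerDl !innerNl (innerC q' p (symG Ux)) (innerC q p' (symG Ux)).
move: (inner _ A W) (inner _ A' Z) (inner _ B W) (inner _ B' Z) (inner _ p q')
  (inner _ p' q) => e e' f f' i j E1 E2; lra.
Qed.

End CurvatureSkew.

(** * The Ricci tensor on the image of the curvature *)

Section EinsteinAlgebra.
Variables (R : realType) (n : nat) (B : 'M[R]_n) (S : 'rV[R]_n -> 'rV[R]_n -> R).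
Hypotheses (n_gt0 : (0 < n)%N) (unitB : B \in unitmx) (symB : B^T = B)
  (linS : forall Y, linear_for *%R (S Y)).
Implicit Types X Y V W : 'rV[R]_n.

Definition ricci_defect X Y V W : R :=
  S Y V * inner B X W - S X V * inner B Y W
  + S Y W * inner B X V - S X W * inner B Y V.

Lemma ricci_defect_rank1 V : V != 0 -> (forall X Y W, ricci_defect X Y V W = 0) ->
  exists theta : 'rV[R]_n -> R, forall Y W,
    S Y W = metric_trace B S / n%:R * inner B Y W + theta W * inner B Y V.
Proof.
move=> V0 F0; have [X XV] := inner_neq0 unitB symB V0.
set c := S X V.
(* Setting [W = V] makes [V] an eigenvector of [S]. The equation for general [W] then determines [S]
   completely. *)
have SV Y : S Y V = c * inner B Y V.
  have := F0 X Y V; rewrite /ricci_defect XV -/c => H.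
  by apply/eqP; rewrite -subr_eq0; apply/eqP; lra.
pose theta W := S X W - c * inner B X W.
have SE Y W : S Y W = c * inner B Y W + theta W * inner B Y V.
  have := F0 X Y W; rewrite /ricci_defect XV SV -/c /theta => H.
  by apply/eqP; rewrite -subr_eq0; apply/eqP; lra.
have theta_lin : linear_for *%R theta.
  by move=> a W W'; rewrite /theta linS innerDr innerZr; ring.
have traceS : metric_trace B S = c * n%:R.
  (* The rank-one term has trace [theta V], so it is trace-free and [c] is the trace of [S] divided
     by [n]. *)
  have thetaV : theta V = 0 by rewrite /theta XV -/c mulr1 subrr.
  rewrite -(metric_trace_inner unitB symB) -[RHS]addr0 -{1}thetaV.
  rewrite -(metric_trace_innerl V unitB symB theta_lin) /metric_trace mulr_sumr.
  rewrite -big_split; apply: eq_bigr => i _ /=.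
  rewrite mulr_sumr -big_split; apply: eq_bigr => j _ /=.
  by rewrite SE; ring.
exists theta => Y W; rewrite traceS mulfK ?SE //.
by rewrite pnatr_eq0 -lt0n.
Qed.

(** The coefficient of the metric in [ricci_defect_rank1] is the same for [V] and [V'], so the
    rank-one terms coincide. They are compared at a [W0] where [S] differs from the multiple of the
    metric. *)
Lemma ricci_defect_collinear V : V != 0 ->
  (forall X Y W, ricci_defect X Y V W = 0) ->
  (exists Y W, S Y W != metric_trace B S / n%:R * inner B Y W) ->
  forall V', (forall X Y W, ricci_defect X Y V' W = 0) -> exists c, V' = c *: V.
Proof.
move=> V0 FV [Y0 [W0 SYW]] V' FV'.
have [->|V'0] := eqVneq V' 0; first by exists 0; rewrite scale0r.
have [theta thE] := ricci_defect_rank1 V0 FV.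
have [theta' thE'] := ricci_defect_rank1 V'0 FV'.
have EV : theta W0 *: V = theta' W0 *: V'.
  apply/eqP; rewrite -subr_eq0; apply/eqP; apply: (inner_eq0 unitB) => Y.
  rewrite innerDl innerNl !innerZl !(innerC _ Y symB); apply/eqP.
  rewrite subr_eq0; apply/eqP; apply: (@addrI _ (metric_trace B S / n%:R * inner B Y W0)).
  by rewrite -thE -thE'.
have th'0 : theta' W0 != 0.
  by apply: contra SYW => /eqP th0; rewrite thE' th0 mul0r addr0.
exists ((theta' W0)^-1 * theta W0).
by rewrite -scalerA EV scalerA mulVf // scale1r.
Qed.

End EinsteinAlgebra.

(** * The equivalence at a single point *)

Section Pointwise.
Variables (R : realType) (n : nat) (U : set 'rV[R]_n) (G : 'rV[R]_n -> 'M[R]_n)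
  (x : 'rV[R]_n).
Hypotheses (n_gt1 : (1 < n)%N) (oU : open U) (smG : smooth_on U G)
  (symG : forall x, U x -> (G x)^T = G x) (unitG : forall x, U x -> G x \in unitmx)
  (Ux : U x).
Implicit Types X Y V W Z : 'rV[R]_n.

Let skew := riemann04_skew oU smG symG unitG.

Lemma riemann04_alt X Y Z : riemann04 G x X Y Z Z = 0.
Proof. by have := skew X Y Z Z Ux; lra. Qed.

(** Skew-symmetry moves the argument from the third slot of the curvature to the fourth, where
    linearity is that of the inner product. *)
Lemma ricci_linear Y : linear_for *%R (ricci G x Y).
Proof.
move=> a W W'; rewrite /ricci /metric_trace mulr_sumr -big_split.
apply: eq_bigr => i _ /=; rewrite mulr_sumr -big_split; apply: eq_bigr => j _ /=.
rewrite skew // [riemann04 _ _ _ _ W _]skew // [riemann04 _ _ _ _ W' _]skew //.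
by rewrite /riemann04 innerDr innerZr; ring.
Qed.

Lemma inner_projective13 X Y Z W :
  inner (G x) (projective13 G x X Y Z) W = projective04 G x X Y Z W.
Proof.
rewrite inner_sharp //; first exact: unitG.
move=> a W1 W2; rewrite /projective04 /riemann04.
move: (riemann13 G x X Y Z) (ricci G x Y Z) (ricci G x X Z) => V s s'.
rewrite !innerDr !innerZr.
move: (inner _ V W1) (inner _ V W2) (inner _ X W1) (inner _ X W2)
  (inner _ Y W1) (inner _ Y W2) => *; ring.
Qed.

Lemma projective04_symmetrized X Y V W :
  projective04 G x X Y V W + projective04 G x X Y W V =
  - (n%:R - 1)^-1 * ricci_defect (G x) (ricci G x) X Y V W.
Proof.
rewrite /projective04 (skew X Y V W Ux) /ricci_defect.
move: (riemann04 G x X Y W V) (ricci G x Y V) (ricci G x X V) (ricci G x Y W)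
  (ricci G x X W) (inner _ X W) (inner _ Y W) (inner _ X V) (inner _ Y V) => *; ring.
Qed.

Lemma dot_commute_iff X1 X2 X3 X4 X Y :
  inner (G x) (dot13 (projective13 G x) (riemann13 G x) X1 X2 X3 X Y) X4
    = dot04 (projective13 G x) (riemann04 G x) X1 X2 X3 X4 X Y
  <-> ricci_defect (G x) (ricci G x) X Y (riemann13 G x X1 X2 X3) X4 = 0.
Proof.
have n1 : n%:R - 1 != 0 :> R.
  by rewrite subr_eq0 pnatr_eq1 gtn_eqF.
have E := projective04_symmetrized X Y (riemann13 G x X1 X2 X3) X4.
set D := ricci_defect _ _ _ _ _ _ in E *.
(* The terms in which P acts on [X1], [X2], [X3] occur on both sides. What remains is
   $P(X,Y,V,X_4)+P(X,Y,X_4,V)=0$ with $V=\mathcal R(X_1,X_2)X_3$. *)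
have -> : (inner (G x) (dot13 (projective13 G x) (riemann13 G x) X1 X2 X3 X Y) X4
    = dot04 (projective13 G x) (riemann04 G x) X1 X2 X3 X4 X Y)
  = (- (n%:R - 1)^-1 * D = 0).
  rewrite -E -!inner_projective13 /dot13 /dot04 /riemann04.
  move: (riemann13 G x (projective13 G x X Y X1) X2 X3)
    (riemann13 G x X1 (projective13 G x X Y X2) X3)
    (riemann13 G x X1 X2 (projective13 G x X Y X3)) => V1 V2 V3.
  move: (riemann13 G x X1 X2 X3) (projective13 G x X Y X4) => V P4.
  move: (projective13 G x X Y V) => PV.
  rewrite !innerDl !innerNl (innerC V P4 (symG Ux)).
  move: (inner _ PV X4) (inner _ P4 V) (inner _ V1 X4) (inner _ V2 X4)
    (inner _ V3 X4) => *; apply/propext; split; lra.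
split=> [/eqP|->]; last by rewrite mulr0.
by rewrite mulf_eq0 oppr_eq0 invr_eq0 (negbTE n1) => /eqP.
Qed.

Lemma einstein_iff_ricci_defect :
  (forall X Y, ricci G x X Y = scalar_curvature G x / n%:R * inner (G x) X Y) <->
  (forall X Y X1 X2 X3 W,
     ricci_defect (G x) (ricci G x) X Y (riemann13 G x X1 X2 X3) W = 0).
Proof.
split=> [ein X Y X1 X2 X3 W|F0].
  by rewrite /ricci_defect !ein; ring.
have n_gt0 := ltnW n_gt1.
(* Where the curvature vanishes, so do the Ricci tensor and the scalar curvature. *)
have [V0|] := pselect (forall X1 X2 X3, riemann13 G x X1 X2 X3 = 0).
  have S0 X Y : ricci G x X Y = 0.
    rewrite /ricci /metric_trace big1 // => i _; rewrite big1 // => j _.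
    by rewrite /riemann04 V0 /inner !mul0mx mxE mulr0.
  move=> X Y; rewrite S0 /scalar_curvature /metric_trace big1 ?mul0r // => i _.
  by rewrite big1 // => j _; rewrite S0 mulr0.
move=> /existsNP[Z1 /existsNP[Z2 /existsNP[Z3 /eqP V0]]].
apply: contrapT => nein.
have {}nein : exists X Y,
    ricci G x X Y != metric_trace (G x) (ricci G x) / n%:R * inner (G x) X Y.
  by move/existsNP: nein => [X /existsNP[Y /eqP SXY]]; exists X, Y.
have FV X Y W := F0 X Y Z1 Z2 Z3 W.
move/negP: (V0); case; apply/eqP; apply: (inner_eq0 (unitG Ux)) => W.
(* Since $\mathcal R(Z_1,Z_2)W = cV$ with $V=\mathcal R(Z_1,Z_2)Z_3$, one gets
   $g(V,W)=-R(Z_1,Z_2,W,Z_3)=-c\,R(Z_1,Z_2,Z_3,Z_3)=0$ for every [W], against $V\ne0$. *)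
have [c Ec] := ricci_defect_collinear n_gt0 (unitG Ux) (symG Ux) ricci_linear
  V0 FV nein (fun X Y W' => F0 X Y Z1 Z2 W W').
rewrite -/(riemann04 G x Z1 Z2 Z3 W) skew // /riemann04 Ec innerZl.
by rewrite -/(riemann04 G x Z1 Z2 Z3 Z3) riemann04_alt mulr0 oppr0.
Qed.

End Pointwise.

Theorem theorem4p6 (R : realType) (n : nat) (n_ge3 : (3 <= n)%N)
    (M : smoothManifold R n) (M_connected : connected [set: M])
    (g : semiRiemannianMetric M) :
  (forall (X1 X2 X3 X4 X Y : vectorField M) (a : chart M) (x : 'rV[R]_n),
     chart_image a x ->
     inner (g a x)
       (dot13 (projective13 (g a) x) (riemann13 (g a) x)
          (X1 a x) (X2 a x) (X3 a x) (X a x) (Y a x))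
       (X4 a x)
     = dot04 (projective13 (g a) x) (riemann04 (g a) x)
         (X1 a x) (X2 a x) (X3 a x) (X4 a x) (X a x) (Y a x))
  <-> einstein g.
Proof.
have n_gt1 : (1 < n)%N by exact: leq_trans n_ge3.
have oU := @chart_image_open _ _ M; have smg := @gram_smooth _ _ _ g.
have symg := @gram_sym _ _ _ g; have ug := @gram_nondegenerate _ _ _ g.
split=> [dotE a x ax|ein X1 X2 X3 X4 X Y a x ax].
  apply/(einstein_iff_ricci_defect n_gt1 (oU a) (smg a) (symg a) (ug a) ax).
  move=> X Y X1 X2 X3 X4.
  apply/(dot_commute_iff n_gt1 (oU a) (smg a) (symg a) (ug a) ax).
  (* The six tangent vectors at [x] become values of global fields, to which the assumed identity
     applies. *)
  have [FX <-] := tangent_extension X ax; have [FY <-] := tangent_extension Y ax.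
  have [F1 <-] := tangent_extension X1 ax; have [F2 <-] := tangent_extension X2 ax.
  have [F3 <-] := tangent_extension X3 ax; have [F4 <-] := tangent_extension X4 ax.
  exact: dotE.
apply/(dot_commute_iff n_gt1 (oU a) (smg a) (symg a) (ug a) ax).
apply: (einstein_iff_ricci_defect n_gt1 (oU a) (smg a) (symg a) (ug a) ax).1.
exact: ein.
Qed.
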